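(* Let $((\mathbf{u},p),(\boldsymbol{\phi},r),\mathbf{y})\in V\times V\times Q_{ad}$ solve the continuous optimality system and let $((\mathbf{u}_h,p_h),(\boldsymbol{\phi}_h,r_h),\mathbf{y}_h)\in V_h\times V_h\times Q_{ad}^h$ solve the discrete optimality system (both written out in the context). Let $P_h\mathbf{u},\bar P_h\boldsymbol{\phi}\in X_h$ and $R_hp\in M_h$ be the projections defined in the context. Then there is a constant $C>0$, independent of the mesh-size, such that $$\|p-p_h\|_M\le C\big(\|p-R_hp\|_M+\|\mathbf u-P_h\mathbf u\|_h+\|\boldsymbol\phi-\bar P_h\boldsymbol\phi\|_h+\|E\boldsymbol\phi-\Pi_h(E\boldsymbol\phi)\|_Q+\|\mathbf y-\Pi_h\mathbf y\|_Q\big).$$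
   Context: All vector spaces are real. Continuous setting. $X,M,W,Q$ are Hilbert spaces, $V=X\times M$, with $X\subset W\subset X'$ with continuous inclusions ($X'$ the dual of $X$). $E:X\to Q$ is continuous and linear; $Q_{ad}\subset Q$ is nonempty, closed and convex. $\mathbf f,\mathbf u_d\in W$ and $\lambda>0$ are given. $a:X\times X\to\mathbb R$, $b:X\times M\to\mathbb R$ are continuous bilinear forms with $|a(\mathbf v,\mathbf z)|\le C_1\|\mathbf v\|_X\|\mathbf z\|_X$ and $|b(\mathbf z,p)|\le C_2\|\mathbf z\|_X\|p\|_M$; with $Z=\{\mathbf v\in X: b(\mathbf v,w)=0\ \forall w\in M\}$, $a$ is $Z$-elliptic: $\alpha\|\mathbf v\|_X^2\le a(\mathbf v,\mathbf v)$ for all $\mathbf v\in Z$, $\alpha>0$; and $b$ satisfies the inf-sup condition $\inf_{p\in M}\sup_{\mathbf z\in X} b(\mathbf z,p)/(\|\mathbf z\|_X\|p\|_M)\ge\beta>0$. Continuous optimality system for $((\mathbf u,p),(\boldsymbol\phi,r),\mathbf y)\in V\times V\times Q_{ad}$: for all $\mathbf z\in X$, $w\in M$, $\mathbf x\in Q_{ad}$, $a(\mathbf u,\mathbf z)+b(\mathbf z,p)=\langle\mathbf y,E\mathbf z\rangle_Q+\langle\mathbf f,\mathbf z\rangle_W$, $b(\mathbf u,w)=0$, $a(\mathbf z,\boldsymbol\phi)-b(\mathbf z,r)=\langle\mathbf u-\mathbf u_d,\mathbf z\rangle_W$, $b(\boldsymbol\phi,w)=0$, $\langle E\boldsymbol\phi+\lambda\mathbf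 y,\mathbf x-\mathbf y\rangle_Q\ge0$. Discrete setting. $X_h\subset W$ is a finite dimensional subspace, $\|\cdot\|_h$ is a norm on $X+X_h$ with $\|\mathbf v\|_h=\|\mathbf v\|_X$ for $\mathbf v\in X$; $M_h\subset M$ is a finite dimensional subspace with norm $\|\cdot\|_M$; $V_h=X_h\times M_h$; $Q_h\subseteq Q$ is a finite dimensional subspace and $Q_{ad}^h\subset Q_{ad}$ is a nonempty closed convex subset of $Q_h$. $a_h:X_h\times X_h\to\mathbb R$, $b_h:X_h\times M_h\to\mathbb R$ are bilinear with $|a_h(\mathbf v_h,\mathbf z_h)|\le\bar C_1\|\mathbf v_h\|_h\|\mathbf z_h\|_h$, $|b_h(\mathbf z_h,p_h)|\le\bar C_2\|\mathbf z_h\|_h\|p_h\|_M$; with $Z_h=\{\mathbf v_h\in X_h:b_h(\mathbf v_h,w_h)=0\ \forall w_h\in M_h\}$, $\bar\alpha\|\mathbf v_h\|_h^2\le a_h(\mathbf v_h,\mathbf v_h)$ on $Z_h$, $\bar\alpha>0$; and $\inf_{p_h\in M_h}\sup_{\mathbf z_h\in X_h}b_h(\mathbf z_h,p_h)/(\|\mathbf z_h\|_h\|p_h\|_M)\ge\bar C>0$. $E_h:X_h+X\to Q$ is linear with $E_h\mathbf v=E\mathbf v$ for $\mathbf v\in X$. Discrete optimality system for $((\mathbf u_h,p_h),(\boldsymbol\phi_h,r_h),\mathbf y_h)\in V_h\times V_h\times Q_{ad}^h$: for all $\mathbf z_h\in X_h$, $w_h\in M_h$, $\mathbf x_h\in Q_{ad}^h$,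 $a_h(\mathbf u_h,\mathbf z_h)+b_h(\mathbf z_h,p_h)=\langle\mathbf y_h,E_h\mathbf z_h\rangle_Q+\langle\mathbf f,\mathbf z_h\rangle_W$, $b_h(\mathbf u_h,w_h)=0$, $a_h(\mathbf z_h,\boldsymbol\phi_h)-b_h(\mathbf z_h,r_h)=\langle\mathbf u_h-\mathbf u_d,\mathbf z_h\rangle_W$, $b_h(\boldsymbol\phi_h,w_h)=0$, $\langle E_h\boldsymbol\phi_h+\lambda\mathbf y_h,\mathbf x_h-\mathbf y_h\rangle_Q\ge0$. Standing assumptions. (I) $\|\mathbf v\|_W\le C_W\|\mathbf v\|_h$ for all $\mathbf v\in X+X_h$. (II) $\|E_h(\mathbf v-\mathbf v_h)\|_Q\le\|\mathbf v-\mathbf v_h\|_h$ for all $\mathbf v\in X,\mathbf v_h\in X_h$. (III) $\Pi_h:Q\to Q_h$ is the $Q$-orthogonal projection, and $\Pi_h\mathbf x\in Q_{ad}^h$ whenever $\mathbf x\in Q_{ad}$. Projections. $(P_h\mathbf u,R_hp),(\bar P_h\boldsymbol\phi,\bar R_hr)\in X_h\times M_h$ are the unique solutions of: for all $\mathbf z_h\in X_h$, $w_h\in M_h$, $a_h(P_h\mathbf u,\mathbf z_h)+b_h(\mathbf z_h,R_hp)=\langle\mathbf y,E_h\mathbf z_h\rangle_Q+\langle\mathbf f,\mathbf z_h\rangle_W$, $b_h(P_h\mathbf u,w_h)=0$, $a_h(\mathbf z_h,\bar P_h\boldsymbol\phi)-b_h(\mathbf z_h,\bar R_hr)=\langle\mathbf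 u-\mathbf u_d,\mathbf z_h\rangle_W$, $b_h(\bar P_h\boldsymbol\phi,w_h)=0$. ''Independent of the mesh-size'' means: depending only on $\lambda$ and on the constants $C_1,C_2,\alpha,\beta,\bar C_1,\bar C_2,\bar\alpha,\bar C,C_W$. *)

(* Defs.v *)
(* Real Hilbert spaces, subspaces of modules as types, and the state, adjoint
   and variational relations of a saddle-point optimal control problem, in
   MathComp-Analysis. *)
From HB Require Import structures.
From mathcomp Require Import all_boot all_order all_algebra.
From mathcomp Require Import sesquilinear.
From mathcomp Require Import all_classical all_reals all_analysis.

Set Implicit Arguments.
Unset Strict Implicit.
Unset Printing Implicit Defensive.

Import Order.TTheory GRing.Theory Num.Theory.
Import numFieldNormedType.Exports.

Local Open Scope classical_set_scope.
Local Open Scope ring_scope.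

HB.mixin Record NormedModule_hasInner (R : realType) V
    of NormedModule R V := {
  inner : {dot V for idfun};
  norm_inner : forall x : V, `|x| ^+ 2 = inner x x
}.

#[short(type="hilbertType")]
HB.structure Definition Hilbert (R : realType) :=
  {V of CompleteNormedModule R V & NormedModule_hasInner R V}.

Notation "''[' x , y ]" := (inner x y) : ring_scope.

(* The elements of a subspace S of V, as an lmodType of its own; the inclusion
   into V is val. *)
Section SubspaceType.
Context (R : realType) (V : lmodType R) (S : submodClosed V).

Record subsp := Subsp { subsp_val : V; subsp_valP : subsp_val \in S }.

HB.instance Definition _ := [isSub for subsp_val].
HB.instance Definition _ := [Choice of subsp by <:].
HB.instance Definition _ := [SubChoice_isSubLmodule of subsp by <:].

End SubspaceType.

Definition finite_dim (R : realType) (U : lmodType R) : Prop :=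
  exists (n : nat) (e : 'I_n -> U),
    forall v : U, exists c : 'I_n -> R, v = \sum_(i < n) c i *: e i.

(* The subspace X + S of W, where X is a subspace of W through the linear
   injection i : X -> W. *)
Section SumSpace.
Context (R : realType) (X W : lmodType R) (i : {linear X -> W}).
Context (S : submodClosed W).

Definition in_sumsp (w : W) : bool :=
  `[< exists v : X, exists2 s : W, s \in S & w = i v + s >].

Fact sumsp_submod : submod_closed (in_sumsp : {pred W}).
Proof.
split=> [|a _ _ /asboolP[v [s sS ->]] /asboolP[v' [s' s'S ->]]].
  by apply/asboolP; exists 0, 0; rewrite ?rpred0// linear0 addr0.
apply/asboolP; exists (a *: v + v'), (a *: s + s').
  by rewrite rpredD// rpredZ.
by rewrite linearP scalerDr addrACA.
Qed.

HB.instance Definition _ :=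
  GRing.isSubmodClosed.Build R W in_sumsp sumsp_submod.

Definition sumsp : submodClosed W := GRing.SubmodClosed.clone R W in_sumsp _.

Fact sumspl_subproof (v : X) : i v \in sumsp.
Proof. by apply/asboolP; exists v, 0; rewrite ?rpred0// addr0. Qed.

Fact sumspr_subproof (s : subsp S) : val s \in sumsp.
Proof. by apply/asboolP; exists 0, (val s); rewrite ?subsp_valP// linear0 add0r. Qed.

Definition sumspl (v : X) : subsp sumsp := Subsp (sumspl_subproof v).
Definition sumspr (s : subsp S) : subsp sumsp := Subsp (sumspr_subproof s).

Fact sumspl_linear : linear sumspl.
Proof. by move=> a u v; apply/val_inj => /=; rewrite linearP. Qed.

Fact sumspr_linear : linear sumspr.
Proof. by move=> a u v; apply/val_inj. Qed.

HB.instance Definition _ :=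
  GRing.isLinear.Build R X (subsp sumsp) _ sumspl sumspl_linear.
HB.instance Definition _ :=
  GRing.isLinear.Build R (subsp S) (subsp sumsp) _ sumspr sumspr_linear.

End SumSpace.

Section Norms.
Context (R : realType).

Record is_norm (U : lmodType R) (N : U -> R) : Prop := IsNorm {
  is_normD : forall x y, N (x + y) <= N x + N y;
  is_normZ : forall (a : R) x, N (a *: x) = `|a| * N x;
  is_norm0 : forall x, N x = 0 -> x = 0
}.

(* The inclusions X -> W -> X' of a pivot space W: i, and the map sending w to
   the functional <w, i .>_W, whose boundedness for the dual norm is spelled
   out. *)
Definition pivot_inclusions (X W : hilbertType R) (i : {linear X -> W}) : Prop :=
  [/\ injective i,
      continuous i,
      injective (fun (w : W) (v : X) => '[w, i v])
    & exists C : R, forall (w : W) (v : X), `|'[w, i v]| <= C * `|w| * `|v|].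

Definition orthogonal_projection (Q : hilbertType R) (S : submodClosed Q)
    (P : Q -> subsp S) : Prop :=
  forall (x : Q) (s : subsp S), '[x - val (P x), val s] = 0.

End Norms.

Section Forms.
Context (R : realType) (U N : lmodType R) (nU : U -> R) (nN : N -> R).

(* For a bilinear form on normed spaces this is continuity with constant C. *)
Definition bounded_form (c : U -> N -> R) (C : R) : Prop :=
  forall v w, `|c v w| <= C * nU v * nN w.

Definition form_kernel (b : U -> N -> R) : set U :=
  [set v | forall w, b v w = 0].

Definition elliptic_on (Z : set U) (a : U -> U -> R) (alpha : R) : Prop :=
  forall v, Z v -> alpha * nU v ^+ 2 <= a v v.

(* The quotient only makes sense for z and p nonzero. The infimum and supremum
   are those of the extended reals, so that over the empty set they are +oo
   and -oo; those of R would be 0. *)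
Definition inf_sup (b : U -> N -> R) (beta : R) : Prop :=
  (beta%:E <= ereal_inf
     [set ereal_sup
        [set (b z p / (nU z * nN p))%:E | z in [set z | z != 0%R]]
       | p in [set p | p != 0%R]])%E.

End Forms.

(* One definition serves the continuous problem and its discretisation: U is
   the space of velocities, N that of pressures, E : U -> Q the control
   operator, i : U -> W the inclusion into the pivot space, K the set of
   admissible controls. *)
Section OptimalitySystem.
Context (R : realType) (U N : lmodType R) (W Q : hilbertType R).
Context (a : U -> U -> R) (b : U -> N -> R) (E : U -> Q) (i : U -> W).

Definition state_eq (y : Q) (f : W) (u : U) (p : N) : Prop :=
  (forall z, a u z + b z p = '[y, E z] + '[f, i z]) /\
  (forall w, b u w = 0).

Definition adjoint_eq (g : W) (phi : U) (r : N) : Prop :=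
  (forall z, a z phi - b z r = '[g, i z]) /\
  (forall w, b phi w = 0).

Definition optimality_system (lambda : R) (f ud : W) (K : set Q)
    (u : U) (p : N) (phi : U) (r : N) (y : Q) : Prop :=
  [/\ K y,
      state_eq y f u p,
      adjoint_eq (i u - ud) phi r
    & forall x, K x -> 0 <= '[E phi + lambda *: y, x - y]].

End OptimalitySystem.

(* Main.v *)
Require Import Defs.
From mathcomp Require Import all_boot all_order all_algebra.
From mathcomp Require Import sesquilinear.
From mathcomp Require Import all_classical all_reals all_analysis.
From mathcomp Require Import ring lra.

Import Order.TTheory GRing.Theory Num.Theory.
Import numFieldNormedType.Exports.

Local Open Scope classical_set_scope.
Local Open Scope ring_scope.

(** The errors [uh - Phu] and [ph - Rhp] solve a discrete saddle point problem
    whose data is [yh - y], so ellipticity and the inf-sup condition bound both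
    by [`|y - yh|]. For the controls, testing the two variational inequalities
    with [yh] and [Pih y] leaves the term [<Eh (phih - bPhphi), y - yh>], which
    the discrete state and adjoint equations turn into
    [<uh - u, Phu - uh>] in [W]; its quadratic part in [uh - Phu] is negative,
    so only the projection error of [u] survives. *)

Section InnerProduct.
Context (R : realType) (V : hilbertType R).
Implicit Types x y z : V.

Lemma innerC x y : '[x, y] = '[y, x].
Proof. by rewrite hermC /= expr0 mul1r. Qed.

Lemma innerDl x y z : '[x + y, z] = '[x, z] + '[y, z].
Proof. exact: linearDl. Qed.

Lemma innerDr x y z : '[x, y + z] = '[x, y] + '[x, z].
Proof. exact: linearDr. Qed.

Lemma innerNl x y : '[- x, y] = - '[x, y].
Proof. exact: linearNl. Qed.

Lemma innerNr x y : '[x, - y] = - '[x, y].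
Proof. exact: linearNr. Qed.

Lemma innerZl (t : R) x y : '[t *: x, y] = t * '[x, y].
Proof. exact: linearZl_LR. Qed.

Lemma innerZr (t : R) x y : '[x, t *: y] = t * '[x, y].
Proof. by rewrite innerC innerZl innerC. Qed.

Definition innerE := (innerDl, innerDr, innerNl, innerNr, innerZl, innerZr).

(** Cauchy-Schwarz: the square of [|y| *: x - |x| *: y] is nonnegative, and its expansion is divided
    by [|x| * |y|]. *)
Lemma inner_le_norm x y : '[x, y] <= `|x| * `|y|.
Proof.
have [->|x0] := eqVneq x 0.
  by rewrite -(scale0r 0) innerZl !scale0r normr0 !mul0r.
have [->|y0] := eqVneq y 0.
  by rewrite -(scale0r 0) innerZr !scale0r normr0 mulr0 mul0r.
have nx : 0 < `|x| by rewrite normr_gt0.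
have ny : 0 < `|y| by rewrite normr_gt0.
have : 0 <= '[`|y| *: x - `|x| *: y, `|y| *: x - `|x| *: y].
  by rewrite -norm_inner exprn_ge0.
rewrite !innerE (innerC y x) -!norm_inner => h.
rewrite -(ler_pM2l (mulr_gt0 nx ny)); nra.
Qed.

Lemma inner_norm_le x y (c d : R) : `|x| <= c -> `|y| <= d -> '[x, y] <= c * d.
Proof.
by move=> xc yd; apply: (le_trans (inner_le_norm _ _)); apply: ler_pM.
Qed.

End InnerProduct.

Section Norm.
Context (R : realType) (U : lmodType R) (n : U -> R) (nP : is_norm n).

Lemma is_norm00 : n 0 = 0.
Proof. by rewrite -(scale0r 0) (is_normZ nP) normr0 mul0r. Qed.

Lemma is_normN x : n (- x) = n x.
Proof. by rewrite -scaleN1r (is_normZ nP) normrN1 mul1r. Qed.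

Lemma is_norm_ge0 x : 0 <= n x.
Proof.
by have := is_normD nP x (- x); rewrite subrr is_norm00 is_normN; lra.
Qed.

Lemma is_norm_gt0 x : x != 0 -> 0 < n x.
Proof.
move=> x0; rewrite lt_neqAle is_norm_ge0 andbT eq_sym.
by apply: contra_neq x0 => /(is_norm0 nP).
Qed.

(** Serves to pull the norm of the sum space back to the discrete velocities and the norm of [M]
    back to the discrete pressures. *)
Lemma is_norm_comp (U' : lmodType R) (g : {linear U' -> U}) :
  injective g -> is_norm (n \o g).
Proof.
move=> g_inj; split=> [x y|t x|x] /=.
- by rewrite linearD; exact: is_normD.
- by rewrite linearZ /= (is_normZ nP).
- by move=> /(is_norm0 nP); rewrite -(linear0 g); exact: g_inj.
Qed.

End Norm.

Lemma normr_is_norm (R : realType) (V : normedModType R) :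
  is_norm (fun v : V => `|v|).
Proof.
by split=> [x y|t x|x]; [exact: ler_normD|exact: normrZ|exact: normr0_eq0].
Qed.

Section SaddlePoint.
Context (R : realType) (U N : lmodType R) (nU : U -> R) (nN : N -> R).
Context (nUP : is_norm nU) (nNP : is_norm nN).

Lemma elliptic_le (Z : set U) (a : U -> U -> R) (alpha K : R) (v : U) :
  elliptic_on nU Z a alpha -> 0 <= K -> Z v -> a v v <= K * nU v ->
  alpha * nU v <= K.
Proof.
move=> ell K0 /ell av avK; have := is_norm_ge0 _ _ nU nUP v.
rewrite le_eqVlt => /predU1P[<-|v0]; first by rewrite mulr0.
by rewrite -(ler_pM2r v0) -mulrA -expr2 (le_trans av).
Qed.

(** For [p != 0] the bound on [b z p] caps every quotient in the supremum by [K / nN p]. The case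
    [p = 0] is separate because the infimum ranges over nonzero [p] only. *)
Lemma inf_sup_le (b : U -> N -> R) (beta K : R) (p : N) :
  inf_sup nU nN b beta -> 0 <= K -> (forall z, b z p <= K * nU z) ->
  beta * nN p <= K.
Proof.
move=> isb K0 bK; have [->|p0] := eqVneq p 0.
  by rewrite (is_norm00 _ _ nN nNP) mulr0.
have np := is_norm_gt0 _ _ nN nNP _ p0.
rewrite -ler_pdivlMr // -lee_fin; apply: (le_trans isb).
apply: (@le_trans _ _ (ereal_sup
  [set (b z p / (nU z * nN p))%:E | z in [set z | z != 0%R]])).
  by apply: ereal_inf_lbound; exists p.
apply: ge_ereal_sup => _ [z /= z0 <-].
have nz := is_norm_gt0 _ _ nU nUP _ z0.
by rewrite lee_fin invfM mulrA ler_pM2r ?invr_gt0 // ler_pdivrMr.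
Qed.

(** Taking [z = u] removes the [b] term, so ellipticity bounds [u]; then [b z p] is at most
    [K * nU z - a u z], and inf-sup bounds [p]. The absolute value is there because the sign of [Ca]
    is not prescribed. *)
Lemma saddle_point_le (a : U -> U -> R) (b : U -> N -> R)
    (Ca alpha beta K : R) (u : U) (p : N) :
  0 < alpha -> 0 < beta -> 0 <= K ->
  bounded_form nU nU a Ca -> elliptic_on nU (form_kernel b) a alpha ->
  inf_sup nU nN b beta ->
  form_kernel b u -> (forall z, a u z + b z p <= K * nU z) ->
  nU u <= K / alpha /\ nN p <= (1 + `|Ca| / alpha) / beta * K.
Proof.
move=> alpha0 beta0 K0 aC ell isb bu abK.
have uK : nU u <= K / alpha.
  rewrite ler_pdivlMr // mulrC; apply: (elliptic_le _ _ _ _ _ ell K0 bu).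
  by have := abK u; rewrite bu addr0.
split=> //; rewrite mulrAC ler_pdivlMr // mulrC.
apply: (inf_sup_le _ _ _ _ isb) => [|z].
  by rewrite mulr_ge0 // addr_ge0 // divr_ge0 // ltW.
have z0 := is_norm_ge0 _ _ nU nUP z.
have u0 := is_norm_ge0 _ _ nU nUP u.
have auz : - a u z <= `|Ca| * (K / alpha) * nU z.
  apply: (le_trans (ler_norm _)); rewrite normrN; apply: (le_trans (aC u z)).
  apply: ler_wpM2r => //; apply: (@le_trans _ _ (`|Ca| * nU u)).
    by apply: ler_wpM2r => //; exact: ler_norm.
  exact: ler_wpM2l.
have -> : (1 + `|Ca| / alpha) * K * nU z =
    K * nU z + `|Ca| * (K / alpha) * nU z.
  by ring.
by have := abK z; lra.
Qed.

End SaddlePoint.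

(* Sum of the two variational inequalities, the discrete one being tested with
   the projection [Py] of [y]. *)
Lemma control_error_le (R : realType) (Q : hilbertType R) (lambda : R)
    (g gh Pg y yh Py : Q) :
  0 <= '[g + lambda *: y, yh - y] -> 0 <= '[gh + lambda *: yh, Py - yh] ->
  '[y - Py, yh] = 0 -> '[y - Py, Pg] = 0 ->
  lambda * `|y - yh| ^+ 2 <=
    '[gh - g, y - yh] + '[gh - g, Py - y] + '[g - Pg, Py - y].
Proof.
(* Orthogonality turns [Py] into [y] in the product with [yh], and allows [Pg] to be subtracted from
   [g] in the product with [Py - y]. *)
rewrite norm_inner !innerE (innerC _ _ yh y) (innerC _ _ yh Py).
rewrite (innerC _ _ Pg y) (innerC _ _ Pg Py) => vi vih /subr0_eq yyh /subr0_eq yPg.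
by rewrite !yyh yPg in vi vih *; lra.
Qed.

(** If [D <= S], the summand 1 suffices; otherwise [S ^+ 2 <= S * D], and a factor [D] cancels. *)
Lemma le_of_quadratic (R : realType) (lambda A B D S : R) :
  0 < lambda -> 0 <= A -> 0 <= B -> 0 <= S -> 0 <= D ->
  lambda * D ^+ 2 <= A * S * D + B * S ^+ 2 ->
  D <= ((A + B) / lambda + 1) * S.
Proof.
move=> lambda0 A0 B0 S0 D0 quad.
have [DS|SD] := leP D S.
  have : 0 <= (A + B) / lambda by rewrite divr_ge0 ?addr_ge0 // ltW.
  by nra.
have Dgt0 : 0 < D by lra.
have lin : lambda * D <= (A + B) * S.
  have BSD : B * S * S <= B * S * D by rewrite ler_wpM2l ?mulr_ge0 // ltW.
  by rewrite -(ler_pM2r Dgt0); lra.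
rewrite mulrDl mul1r mulrAC; apply: ler_wpDr => //.
by rewrite ler_pdivlMr // mulrC.
Qed.

(** Independence of the mesh-size is expressed by the order of quantifiers: [C] is chosen before all
    spaces, forms and norms. *)
Theorem theorem2p5 (R : realType)
    (lambda C1 C2 alpha beta C1h C2h alphah betah CW : R)
    (lambda_gt0 : 0 < lambda) (alpha_gt0 : 0 < alpha) (beta_gt0 : 0 < beta)
    (alphah_gt0 : 0 < alphah) (betah_gt0 : 0 < betah) :
  exists2 C : R, 0 < C &
  forall
    (* continuous setting *)
    (X M W Q : hilbertType R)
    (iX : {linear X -> W}) (_ : pivot_inclusions iX)
    (E : {linear X -> Q}) (_ : continuous E)
    (Qad : set Q)
    (_ : Qad !=set0) (_ : closed Qad) (_ : convex_set Qad)
    (f ud : W)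
    (a : {bilinear X -> X -> R | *%R & *%R})
    (b : {bilinear X -> M -> R | *%R & *%R})
    (_ : bounded_form (fun v : X => `|v|) (fun z : X => `|z|) a C1)
    (_ : bounded_form (fun z : X => `|z|) (fun p : M => `|p|) b C2)
    (_ : elliptic_on (fun v : X => `|v|) (form_kernel b) a alpha)
    (_ : inf_sup (fun z : X => `|z|) (fun p : M => `|p|) b beta)
    (* discrete setting *)
    (Xh : submodClosed W) (Mh : submodClosed M) (Qh : submodClosed Q)
    (_ : finite_dim (subsp Xh)) (_ : finite_dim (subsp Mh))
    (_ : finite_dim (subsp Qh))
    (normh : subsp (sumsp iX Xh) -> R)
    (_ : is_norm normh)
    (_ : forall v : X, normh (sumspl iX Xh v) = `|v|)
    (Qadh : set Q)
    (_ : Qadh `<=` Qad) (_ : forall x, Qadh x -> x \in Qh)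
    (_ : Qadh !=set0) (_ : closed Qadh) (_ : convex_set Qadh)
    (ah : {bilinear subsp Xh -> subsp Xh -> R | *%R & *%R})
    (bh : {bilinear subsp Xh -> subsp Mh -> R | *%R & *%R})
    (_ : bounded_form (fun vh => normh (sumspr iX vh))
           (fun zh => normh (sumspr iX zh)) ah C1h)
    (_ : bounded_form (fun zh => normh (sumspr iX zh))
           (fun ph : subsp Mh => `|val ph|) bh C2h)
    (_ : elliptic_on (fun vh => normh (sumspr iX vh)) (form_kernel bh)
           ah alphah)
    (_ : inf_sup (fun zh => normh (sumspr iX zh))
           (fun ph : subsp Mh => `|val ph|) bh betah)
    (Eh : {linear subsp (sumsp iX Xh) -> Q})
    (_ : forall v : X, Eh (sumspl iX Xh v) = E v)
    (* standing assumptions (I), (II), (III) *)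
    (_ : forall v : subsp (sumsp iX Xh), `|val v| <= CW * normh v)
    (_ : forall (v : X) (vh : subsp Xh),
           `|Eh (sumspl iX Xh v - sumspr iX vh)|
             <= normh (sumspl iX Xh v - sumspr iX vh))
    (Pih : Q -> subsp Qh)
    (_ : orthogonal_projection Pih)
    (_ : forall x, Qad x -> Qadh (val (Pih x)))
    (* solutions of the continuous and of the discrete optimality system *)
    (u : X) (p : M) (phi : X) (r : M) (y : Q)
    (_ : optimality_system a b E iX lambda f ud Qad u p phi r y)
    (uh : subsp Xh) (ph : subsp Mh) (phih : subsp Xh) (rh : subsp Mh) (yh : Q)
    (_ : optimality_system ah bh (fun zh => Eh (sumspr iX zh)) val
           lambda f ud Qadh uh ph phih rh yh)
    (* projections *)
    (Phu : subsp Xh) (Rhp : subsp Mh) (bPhphi : subsp Xh) (bRhr : subsp Mh)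
    (_ : state_eq ah bh (fun zh => Eh (sumspr iX zh)) val y f Phu Rhp)
    (_ : adjoint_eq ah bh val (iX u - ud) bPhphi bRhr),
  `|p - val ph| <= C * (`|p - val Rhp|
    + normh (sumspl iX Xh u - sumspr iX Phu)
    + normh (sumspl iX Xh phi - sumspr iX bPhphi)
    + `|E phi - val (Pih (E phi))|
    + `|y - val (Pih y)|).
Proof.
(* [k] is the stability constant of the discrete adjoint, [L] that of the discrete pressure, and [T]
   comes from [le_of_quadratic] with [A = 1 + k / alphah] and [B = c ^+ 2 + k + 2]. *)
pose c := `|CW|.
pose k := c ^+ 2 / alphah.
pose T := (1 + k / alphah + (c ^+ 2 + k + 2)) / lambda + 1.
pose L := (1 + `|C1h| / alphah) / betah.
have k_ge0 : 0 <= k by rewrite divr_ge0 ?exprn_ge0 ?normr_ge0 // ltW.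
have c2_ge0 : 0 <= c ^+ 2 by rewrite exprn_ge0 ?normr_ge0.
have ka_ge0 : 0 <= k / alphah by rewrite divr_ge0 // ltW.
have T_ge0 : 0 <= T.
  by rewrite /T addr_ge0 // divr_ge0 ?(ltW lambda_gt0) // !addr_ge0.
have L_ge0 : 0 <= L.
  by rewrite /L divr_ge0 ?(ltW betah_gt0) // addr_ge0 // divr_ge0 // ltW.
exists (1 + L * T); first by have := mulr_ge0 L_ge0 T_ge0; lra.
move=> X M W Q iX _ E _ Qad _ _ _ f ud a b _ _ _ _ Xh Mh Qh _ _ _
  normh normhP _ Qadh QadhS QadhQ _ _ _ ah bh ahC _ ellh isbh
  Eh EhX CWP EhP Pih PihP PihQ u p phi r y [yK _ _ vi]
  uh ph phih rh yh [yhK [uhP bhuh] [phihP bhphih] vih]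
  Phu Rhp bPhphi bRhr [PhuP bhPhu] [bPhphiP bhbPhphi].
pose nh v := normh (sumspr iX v).
have nhP : is_norm nh.
  apply: (is_norm_comp _ _ _ normhP _ (@sumspr _ _ _ iX Xh)).
  by move=> v w /(congr1 val) /= /val_inj.
have nMP : is_norm (fun q : subsp Mh => `|val q|).
  apply: (is_norm_comp _ _ _ (normr_is_norm R M) _
    (val : {linear subsp Mh -> M})).
  exact: val_inj.
pose eu := uh - Phu; pose ep := ph - Rhp.
pose ephi := phih - bPhphi; pose er := rh - bRhr.
set U := normh (_ - sumspr iX Phu); set F := normh (_ - sumspr iX bPhphi).
set G := `|E phi - _|; set Y := `|y - val (Pih y)|; set P := `|p - val Rhp|.
pose D := `|y - yh|.
(* Assumption (II) with continuous argument 0 and discrete argument [- v]. *)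
have Eh_le v : `|Eh (sumspr iX v)| <= nh v.
  have := EhP 0 (- v).
  by rewrite linear0 add0r (linearN (@sumspr _ _ _ iX Xh)) opprK.
have CW_le v : `|val v| <= c * normh v.
  apply: (le_trans (CWP v)); apply: ler_wpM2r; last exact: ler_norm.
  exact: is_norm_ge0.
have euK : form_kernel bh eu by move=> w; rewrite /eu linearBl bhuh bhPhu subrr.
have ephiK : form_kernel bh ephi.
  by move=> w; rewrite /ephi linearBl bhphih bhbPhphi subrr.
have state_err z : ah eu z + bh z ep = '[yh - y, Eh (sumspr iX z)].
  have := uhP z; have := PhuP z.
  rewrite /eu /ep linearBl linearBr !innerE; lra.
have adjoint_err z : ah z ephi - bh z er = '[val uh - iX u, val z].
  have := phihP z; have := bPhphiP z.
  rewrite /ephi /er !linearBr !innerE; lra.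
have DE : `|yh - y| = D by rewrite distrC.
have [eu_le ep_le] : nh eu <= D / alphah /\ `|val ep| <= L * D.
  apply: (saddle_point_le _ _ _ _ _ nhP nMP ah bh) => // [|z].
    exact: normr_ge0.
  by rewrite state_err -DE; apply: inner_norm_le.
pose g := sumspl iX Xh u - sumspr iX Phu.
have uerrE : val uh - iX u = val eu - val g.
  by rewrite /= opprB addrA subrK.
have uerr_le : `|val uh - iX u| <= c * (D / alphah + U).
  rewrite uerrE mulrDr; apply: (le_trans (ler_normB _ _)).
  apply: lerD; last exact: CW_le.
  apply: (le_trans (CW_le (sumspr iX eu))).
  by apply: ler_wpM2l; [exact: normr_ge0|exact: eu_le].
(* The adjoint error equation is tested with [ephi], which lies in the discrete kernel. One factor
   [c] comes from the state error, the other from [ephi] measured in [W]. *)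
have ephi_le : nh ephi <= k * (D / alphah + U).
  have -> : k * (D / alphah + U) = c * (D / alphah + U) * c / alphah.
    by rewrite /k; ring.
  have K_ge0 := le_trans (normr_ge0 _) uerr_le.
  rewrite ler_pdivlMr // mulrC.
  apply: (elliptic_le _ _ nh nhP _ _ _ _ _ ellh _ ephiK).
    by apply: mulr_ge0; [exact: K_ge0|exact: normr_ge0].
  have := inner_norm_le _ _ _ _ _ _ uerr_le (CW_le (sumspr iX ephi)).
  by rewrite -adjoint_err ephiK subr0 mulrA.
have ctrl_le : '[Eh (sumspr iX ephi), y - yh] <= c ^+ 2 * U ^+ 2.
  have -> : '[Eh (sumspr iX ephi), y - yh] = - '[val uh - iX u, val eu].
    (* Cross testing: the adjoint error with [eu], the state error with [ephi]. Both [bh] terms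
       vanish on the kernel; one is reinserted as 0 to match [state_err]. *)
    rewrite -adjoint_err euK subr0 -[ah eu ephi]addr0 -(ephiK ep) state_err.
    by rewrite -innerNl opprB innerC.
  (* What remains is ['[val g, val eu]] minus the square of the norm of [val eu]; by Young's
     inequality that square absorbs the mixed product. *)
  rewrite uerrE innerDl innerNl -norm_inner.
  have gU : `|val g| <= c * U := CW_le g.
  have := inner_le_norm _ _ (val g) (val eu).
  have := normr_ge0 (val eu); have := normr_ge0 (val g).
  have : (`|val g|) ^+ 2 <= (c * U) ^+ 2.
    by rewrite ler_pXn2r ?nnegrE // (le_trans _ gU).
  rewrite exprMn; nra.
have gap : Eh (sumspr iX phih) - E phi =
    Eh (sumspr iX ephi) - Eh (sumspl iX Xh phi - sumspr iX bPhphi).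
  rewrite /ephi (linearB (@sumspr _ _ _ iX Xh)) !(linearB Eh) EhX.
  by rewrite opprB addrA subrK.
have gap_le : `|Eh (sumspr iX phih) - E phi| <= k * (D / alphah + U) + F.
  rewrite gap; apply: (le_trans (ler_normB _ _)); apply: lerD; last exact: EhP.
  exact: le_trans (Eh_le ephi) ephi_le.
have YE : `|val (Pih y) - y| <= Y by rewrite distrC.
(* [yh] is admissible for the continuous inequality and [Pih y] for the discrete one. Both
   orthogonality relations hold because [yh] and [Pih (E phi)] lie in [Qh]. *)
have quad : lambda * D ^+ 2 <=
    c ^+ 2 * U ^+ 2 + F * D + (k * (D / alphah + U) + F) * Y + G * Y.
  have := control_error_le _ _ _ _ _ _ _ _ _ (vi _ (QadhS _ yhK))
    (vih _ (PihQ _ yK)) (PihP y (Subsp (QadhQ _ yhK))) (PihP y (Pih (E phi))).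
  have := inner_norm_le _ _ _ _ _ _ gap_le YE.
  have := inner_norm_le _ _ (E phi - val (Pih (E phi))) _ _ _ (lexx _) YE.
  (* Here [ctrl_le] has to be used: [gap_le] would produce a term [k / alphah * D ^+ 2], which
     [lambda * D ^+ 2] need not absorb. Against [Y] it only gives a term linear in [D]. *)
  have : '[Eh (sumspr iX phih) - E phi, y - yh] <= c ^+ 2 * U ^+ 2 + F * D.
    rewrite gap innerDl; apply: lerD => //.
    by apply: inner_norm_le => //; rewrite normrN; exact: EhP.
  rewrite -/G -/D.
  set t1 := inner _ _; set t2 := inner _ _; set t3 := inner _ _; lra.
have P0 : 0 <= P := normr_ge0 _.
have U0 : 0 <= U := is_norm_ge0 _ _ _ normhP _.
have F0 : 0 <= F := is_norm_ge0 _ _ _ normhP _.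
have G0 : 0 <= G := normr_ge0 _.
have Y0 : 0 <= Y := normr_ge0 _.
have D0 : 0 <= D := normr_ge0 _.
set S := P + U + F + G + Y.
have [S0 US FS GS YS] : [/\ 0 <= S, U <= S, F <= S, G <= S & Y <= S].
  by rewrite /S; split; lra.
have D_le : D <= T * S.
  apply: le_of_quadratic => //; first by rewrite addr_ge0.
    by rewrite !addr_ge0.
  apply: (le_trans quad).
  have h1 : c ^+ 2 * U ^+ 2 <= c ^+ 2 * S ^+ 2.
    by rewrite ler_wpM2l // ler_pXn2r.
  have h2 : F * D <= S * D by rewrite ler_wpM2r.
  have h3 : k / alphah * (D * Y) <= k / alphah * (D * S).
    by rewrite ler_wpM2l // ler_wpM2l.
  have h4 : k * (U * Y) <= k * (S * S) by rewrite ler_wpM2l // ler_pM.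
  have h5 : F * Y <= S * S by rewrite ler_pM.
  have h6 : G * Y <= S * S by rewrite ler_pM.
  have -> : (k * (D / alphah + U) + F) * Y =
    k / alphah * (D * Y) + k * (U * Y) + F * Y by ring.
  lra.
(* The projection error of [p] accounts for the 1 in [1 + L * T]; the discrete part [ep] is at most
   [L * D], hence at most [L * T * S]. *)
have -> : p - val ph = (p - val Rhp) - val ep by rewrite /= opprB addrA subrK.
apply: (le_trans (ler_normB _ _)); rewrite mulrDl mul1r.
apply: lerD; first by rewrite -/P /S; lra.
by apply: (le_trans ep_le); rewrite -(mulrA L) ler_wpM2l.
Qed.
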